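(* Let $r\ge 2$ and $n\ge 1$ be integers, and let $G(r,1,n)=\mathbb{Z}/r\mathbb{Z}\wr S_n$ act on $B(r,n)=\{(b_i\mid 1\le i\le n)\mid 0\le b_i\le r-1\}$ by $$x\,(b_i\mid 1\le i\le n)=(x_i+b_{\sigma^{-1}(i)} \pmod r\mid 1\le i\le n),\qquad x=(x_1,\dots,x_n;\sigma)\in G(r,1,n).$$ Then the stabilizer of $I_0=(0,\dots,0)\in B(r,n)$ is $S_n=\{(0,\dots,0;\sigma)\mid \sigma\in S_n\}\subset G(r,1,n)$.
   Context: $S_n$ is the symmetric group on $\{1,\dots,n\}$. Elements of the wreath product (complex reflection group) $G(r,1,n)=\mathbb{Z}/r\mathbb{Z}\wr S_n$ are written $(x_1,\dots,x_n;\sigma)$ with $x_i\in\mathbb{Z}/r\mathbb{Z}$, $\sigma\in S_n$, and multiplication is $(x_1,\dots,x_n;\sigma)(y_1,\dots,y_n;\tau)=(x_1+y_{\sigma^{-1}(1)},\dots,x_n+y_{\sigma^{-1}(n)};\sigma\tau)$. $S_n$ is regarded as the subgroup $\{(0,\dots,0;\sigma)\}$. The set $B(r,n)$ consists of $n$-tuples of integers in $\{0,\dots,r-1\}$, where $\{0,\dots,r-1\}$ is identified with $\mathbb{Z}/r\mathbb{Z}$. *)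

(* Defs.v *)
From HB Require Import structures.
From mathcomp Require Import all_boot all_order all_algebra all_fingroup.

Set Implicit Arguments.
Unset Strict Implicit.
Unset Printing Implicit Defensive.

Import GRing.Theory.
Local Open Scope group_scope.

(* MathComp's [action] is a right action; the action considered here is a     *)
(* left one.                                                                  *)
Record left_action (gT : finGroupType) (T : Type) := LeftAction {
  lact :> gT -> T -> T;
  lact1 : forall b, lact 1 b = b;
  lactM : forall x y b, lact (x * y) b = lact x (lact y b)
}.

Section Stabilizer.
Variables (gT : finGroupType) (T : eqType) (to : left_action gT T) (b : T).

Definition stabilizer : {set gT} := [set x | to x b == b].

Lemma stabilizer_group_set : group_set stabilizer.
Proof.
apply/group_setP; split=> [|x y]; first by rewrite inE lact1.
by rewrite !inE lactM => /eqP xb /eqP ->; rewrite xb.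
Qed.

Canonical stabilizer_group := Group stabilizer_group_set.
End Stabilizer.

Section Wreath.
Variables r n : nat.

(* G(r,1,n): [Wreath x s] is (x_1, ..., x_n; s).                              *)
Record wreath := Wreath {
  wr_base : {ffun 'I_n -> 'Z_r};
  wr_perm : 'S_n
}.

Definition wreath_to_pair (x : wreath) := (wr_base x, wr_perm x).
Definition pair_to_wreath p := Wreath p.1 p.2.
Lemma wreath_to_pairK : cancel wreath_to_pair pair_to_wreath.
Proof. by case. Qed.

#[hnf] HB.instance Definition _ := Finite.copy wreath (can_type wreath_to_pairK).

Definition wr_one : wreath := Wreath [ffun => 0%R] 1.

(* Permutations compose from right to left on paper, but [s * t] in 'S_n      *)
(* applies s first; hence the reversed product of the permutation parts.      *)
Definition wr_mul (x y : wreath) : wreath :=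
  Wreath [ffun i => (wr_base x i + wr_base y ((wr_perm x)^-1%g i))%R]
         (wr_perm y * wr_perm x).

Definition wr_inv (x : wreath) : wreath :=
  Wreath [ffun i => (- wr_base x (wr_perm x i))%R] (wr_perm x)^-1.

Lemma wr_mulA : associative wr_mul.
Proof.
case=> x s [y t] [z u]; rewrite /wr_mul /= mulgA; congr Wreath.
by apply/ffunP=> i; rewrite !ffunE addrA invMg permM.
Qed.

Lemma wr_mul1 : left_id wr_one wr_mul.
Proof.
case=> x s; rewrite /wr_mul /= mulg1; congr Wreath.
by apply/ffunP=> i; rewrite !ffunE add0r invg1 perm1.
Qed.

Lemma wr_mulV : left_inverse wr_one wr_inv wr_mul.
Proof.
case=> x s; rewrite /wr_mul /= mulgV; congr Wreath.
by apply/ffunP=> i; rewrite !ffunE invgK addNr.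
Qed.

HB.instance Definition _ :=
  Finite_isGroup.Build wreath wr_mulA wr_mul1 wr_mulV.

(* B(r,n). For 1 < r, 'Z_r is 'I_r, i.e. {0, ..., r - 1} with addition mod r. *)
Definition Btuples : Type := {ffun 'I_n -> 'Z_r}.
HB.instance Definition _ := Finite.on Btuples.

Definition wr_act_fun (x : wreath) (b : Btuples) : Btuples :=
  [ffun i => (wr_base x i + b ((wr_perm x)^-1%g i))%R].

Lemma wr_act_val (x : wreath) (b : Btuples) (i : 'I_n) : 1 < r ->
  wr_act_fun x b i = (wr_base x i + b ((wr_perm x)^-1%g i)) %% r :> nat.
Proof. by move=> r_gt1; rewrite ffunE /=; congr (_ %% _); exact: Zp_cast. Qed.

Lemma wr_act1 b : wr_act_fun 1 b = b.
Proof. by apply/ffunP=> i; rewrite !ffunE add0r invg1 perm1. Qed.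

Lemma wr_actM x y b :
  wr_act_fun (x * y) b = wr_act_fun x (wr_act_fun y b).
Proof. by apply/ffunP=> i; rewrite !ffunE /= invMg permM addrA. Qed.

Definition wr_act : left_action wreath Btuples := LeftAction wr_act1 wr_actM.

Definition I0 : Btuples := [ffun => 0%R].

Definition Sn : {set wreath} := [set Wreath [ffun => 0%R] s | s : 'S_n].

Lemma Sn_group_set : group_set Sn.
Proof.
apply/group_setP; split=> [|_ _ /imsetP[s _ ->] /imsetP[t _ ->]].
  by apply/imsetP; exists 1.
apply/imsetP; exists (t * s) => //; congr Wreath.
by apply/ffunP=> i; rewrite !ffunE addr0.
Qed.

Canonical Sn_group := Group Sn_group_set.
End Wreath.

(* Main.v *)
Require Import Defs.
From mathcomp Require Import all_boot all_fingroup all_algebra.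

(** All entries of [I0] are equal, so permuting them changes nothing: an element with base [x] sends
    [I0] to the tuple [x] itself, whatever its permutation. Hence it fixes [I0] exactly when [x] is
    zero. *)

Theorem proposition2p2 (r n : nat) (r_ge2 : 2 <= r) (n_ge1 : 1 <= n) :
  stabilizer (wr_act r n) (I0 r n) = Sn r n.
Proof.
apply/setP=> -[x s]; rewrite inE; apply/eqP/imsetP=> [xI0 | [t _ ->]].
  exists s => //; congr Wreath; apply/ffunP=> i.
  (* Read at [i], the fixed-point equation is [x i + 0 = 0]: the index [s^-1 i] disappears because
     [I0] is constant. *)
  by have /ffunP/(_ i) := xI0; rewrite !ffunE /= GRing.addr0.
by apply/ffunP=> i; rewrite !ffunE /= GRing.addr0.
Qed.
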